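(* Suppose that $0<\epsilon<1/4$. Suppose $X\subset\mathbb{R}$ is a compact set contained in $[-1-\epsilon,-1]\cup[1,1+\epsilon]$, and that it contains at least two distinct points in each of these two intervals. Then there is a real-valued continuous function on $X$ that cannot be uniformly approximated on $X$ by real polynomials that have all their critical points inside $X$.
   Context: The critical points of a polynomial $p$ are all the $z\in\mathbb{C}$ (real or complex) with $p'(z)=0$. *)

(* Defs.v *)
From mathcomp Require Import all_boot all_order all_algebra.
From mathcomp Require Import complex.
From mathcomp Require Import all_classical all_reals all_analysis.

Set Implicit Arguments.
Unset Strict Implicit.
Unset Printing Implicit Defensive.

Import Order.TTheory GRing.Theory Num.Theory.
Import numFieldNormedType.Exports.

Local Open Scope classical_set_scope.
Local Open Scope ring_scope.
Local Open Scope complex_scope.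

(* For a constant polynomial this is all of the complex plane. *)
Definition critical_points (R : realType) (p : {poly R}) : set R[i] :=
  [set z | root (map_poly (real_complex R) p)^`() z].

Definition critical_points_in (R : realType) (X : set R) (p : {poly R}) : Prop :=
  critical_points p `<=` real_complex R @` X.

Definition uniformly_approximable (R : realType) (X : set R)
    (P : set {poly R}) (f : R -> R) : Prop :=
  forall e : R, 0 < e ->
    exists2 p : {poly R}, P p & forall x, X x -> `|p.[x] - f x| < e.

(* Main.v *)
Require Import Defs.
From mathcomp Require Import all_boot all_order all_algebra.
From mathcomp Require Import complex.
From mathcomp Require Import all_classical all_reals all_analysis.
From mathcomp Require Import polyrcf ring lra.

Set Implicit Arguments.
Unset Strict Implicit.
Unset Printing Implicit Defensive.

Import Order.TTheory GRing.Theory Num.Theory.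
Import numFieldNormedType.Exports.

Local Open Scope classical_set_scope.
Local Open Scope ring_scope.

(** Write [p' = c * prod (x - t)] with all [t] in [X], and suppose that at
    least half of the [t] lie in the left interval.  For [x] in the left
    interval a left factor is at most 1/4 and a right one at most 5/2, so a
    left-right pair contributes at most 5/8; for [x] in [[0, 1/4]] the factors
    are at least 1 and 3/4.  Hence [p] varies less on the left interval than on
    [[0, 1/4]].  Let [a] and [b] be the endpoints of the central gap of [X].
    Since [p] is monotone on [[a, b]], the variation of [p] on the left interval
    is at most [|p b - p a|].  If at least half of the [t] are on the right, the
    same bound holds for the right interval.  So [p] cannot approximate
    [(x - a)(x - b)], which vanishes at [a] and [b] and nowhere else in [X]. *)

(** The derivative splits over the complex numbers, and its roots are critical points, so each is
    the image of a point of [X]. The factorization therefore descends to [R] because [map_poly]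
    along [real_complex] is injective. *)
Lemma deriv_split_of_critical_points_in (R : realType) (X : set R)
    (p : {poly R}) :
  critical_points_in X p ->
  exists c (s : seq R), p^`() = c *: \prod_(t <- s) ('X - t%:P) /\
    forall t, t \in s -> X t.
Proof.
move=> pX; set q := (map_poly (real_complex R) p)^`().
have [r qE] := closed_field_poly_normal q.
have rX z : z \in r -> (real_complex R @` X) z.
  move=> zr; apply: pX; rewrite /critical_points /= -/q qE.
  rewrite rootE hornerZ; have /rootP-> : root (\prod_(w <- r) ('X - w%:P)) z.
    by rewrite root_prod_XsubC.
  by rewrite mulr0.
have [s rE sX] : exists2 s, r = map (real_complex R) s & forall t, t \in s -> X t.
  elim: r rX {qE} => [|z r IH] rX; first by exists [::].
  have [t Xt tz] := rX z (mem_head _ _).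
  have [|s -> sX] := IH; first by move=> w wr; apply: rX; rewrite inE wr orbT.
  exists (t :: s); first by rewrite /= tz.
  by move=> w; rewrite inE => /predU1P[->|/sX].
exists (lead_coef p^`()), s; split=> //.
apply: (map_poly_inj (real_complex R)).
rewrite -deriv_map -/q [LHS]qE map_polyZ rmorph_prod /q deriv_map lead_coef_map.
congr (_ *: _); rewrite rE big_map; apply: eq_bigr => t _.
by rewrite rmorphB /= map_polyX map_polyC.
Qed.

(** Each factor outside [P] is paired with one in [P]: the pair gives at most 5/8 at [x] and at
    least 3/4 at [y]. Unpaired factors all lie in [P], and they are at most 1 at [x] and at least 1
    at [y]. *)
Lemma prod_dist_le (R : realFieldType) (P : pred R) (s : seq R) (x y : R) :
  (forall t, t \in s -> P t -> `|x - t| <= 1 / 4 /\ 1 <= `|y - t|) ->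
  (forall t, t \in s -> ~~ P t -> `|x - t| <= 5 / 2 /\ 3 / 4 <= `|y - t|) ->
  (count (predC P) s <= count P s)%N ->
  \prod_(t <- s) `|x - t| <= \prod_(t <- s) `|y - t|.
Proof.
move=> sP sN le_count.
have bound : \prod_(t <- s) `|x - t|
      <= (1 / 4) ^+ count P s * (5 / 2) ^+ count (predC P) s /\
    (3 / 4) ^+ count (predC P) s <= \prod_(t <- s) `|y - t|.
  elim: s sP sN {le_count} => [|t s IH] sP sN.
    by rewrite !big_nil /= !expr0 mulr1.
  have [||IHx IHy] := IH.
  - by move=> w ws; apply: sP; rewrite inE ws orbT.
  - by move=> w ws; apply: sN; rewrite inE ws orbT.
  have x_ge0 : 0 <= \prod_(t <- s) `|x - t| by apply: prodr_ge0.
  have y_ge0 : 0 <= (3 / 4 : R) ^+ count (predC P) s by apply: exprn_ge0; lra.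
  rewrite !big_cons /=; case: (boolP (P t)) => Pt /=; rewrite !(add0n, add1n) exprS.
    have [xt yt] := sP t (mem_head _ _) Pt; split.
      by rewrite -mulrA; apply: ler_pM.
    by rewrite -[leLHS]mul1r; apply: ler_pM.
  have [xt yt] := sN t (mem_head _ _) Pt; split.
    by rewrite mulrCA; apply: ler_pM.
  by rewrite exprS; apply: ler_pM => //; lra.
case: bound => x_le y_ge; apply: le_trans x_le (le_trans _ y_ge).
(* Here [m] counts the pairs and [k] the unpaired factors in [P]; what remains is
   [(1/4)^k * (5/8)^m <= (3/4)^m]. *)
rewrite -(subnK le_count); set m := count (predC P) s; set k := (_ - m)%N.
rewrite exprD -mulrA -exprMn.
rewrite -[leRHS]mul1r; apply: ler_pM; rewrite ?exprn_ge0 ?exprn_ile1 //; try lra.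
by apply: lerXn2r; rewrite ?nnegrE; lra.
Qed.

(** The mean value theorem on both intervals reduces the claim to comparing the derivative at two
    intermediate points, where the factor [c] is common. *)
Lemma variation_le_of_prod (R : rcfType) (p : {poly R}) (c : R) (s : seq R)
    (x y u v : R) :
  p^`() = c *: \prod_(t <- s) ('X - t%:P) ->
  x < y -> u < v -> y - x <= v - u ->
  (forall z w, z \in `]x, y[ -> w \in `]u, v[ ->
     \prod_(t <- s) `|z - t| <= \prod_(t <- s) `|w - t|) ->
  `|p.[y] - p.[x]| <= `|p.[v] - p.[u]|.
Proof.
move=> pE xy uv le_len le_prod.
have [z zI ->] := poly_mvt p xy; have [w wI ->] := poly_mvt p uv.
have dE r : `|p^`().[r]| = `|c| * \prod_(t <- s) `|r - t|.
  rewrite pE hornerZ horner_prod normrM normr_prod.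
  by congr (_ * _); apply: eq_bigr => t _; rewrite hornerXsubC.
rewrite !normrM !dE; apply: ler_pM => //.
- by rewrite mulr_ge0 // prodr_ge0.
- by rewrite ler_wpM2l // le_prod.
- by rewrite !gtr0_norm ?subr_gt0.
Qed.

Lemma variation_le_of_no_root (R : rcfType) (p : {poly R}) (c : R) (s : seq R)
    (a b u v : R) :
  p^`() = c *: \prod_(t <- s) ('X - t%:P) ->
  (forall t, t \in s -> t <= a \/ b <= t) ->
  a < u -> u < v -> v < b -> `|p.[v] - p.[u]| <= `|p.[b] - p.[a]|.
Proof.
move=> pE sab au uv vb.
have same_sign z w : z \in `]a, b[ -> w \in `]a, b[ ->
    0 <= p^`().[z] * p^`().[w].
  rewrite !in_itv /= => /andP[az zb] /andP[aw wb].
  (* The product becomes [c^2] times factors [(z - t) * (w - t)], each nonnegative since no [t]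
     separates [z] from [w]. *)
  rewrite pE !hornerZ !horner_prod mulrACA -expr2 -big_split /=.
  rewrite mulr_ge0 ?sqr_ge0 // big_seq prodr_ge0 // => t ts.
  rewrite !hornerXsubC; case: (sab t ts) => ?.
    by rewrite mulr_ge0 //; lra.
  by rewrite mulr_le0 //; lra.
have [z + zE] := poly_mvt p au; rewrite in_itv /= => /andP[az zu].
have [w + wE] := poly_mvt p uv; rewrite in_itv /= => /andP[uw wv].
have [r + rE] := poly_mvt p vb; rewrite in_itv /= => /andP[vr rb].
have wz : 0 <= (p.[v] - p.[u]) * (p.[u] - p.[a]).
  rewrite wE zE mulrACA mulr_ge0 ?same_sign ?in_itv //=; try lra.
  by rewrite mulr_ge0 //; lra.
have wr : 0 <= (p.[v] - p.[u]) * (p.[b] - p.[v]).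
  rewrite wE rE mulrACA mulr_ge0 ?same_sign ?in_itv //=; try lra.
  by rewrite mulr_ge0 //; lra.
(* After squaring, the difference of the two sides is [2 * D * (P + Q) + (P + Q)^2], which is
   nonnegative by [wz] and [wr]. *)
rewrite -ler_sqr ?nnegrE // !real_normK ?num_real //.
set D := p.[v] - p.[u] in wz wr *; set Q := p.[u] - p.[a] in wz.
set P := p.[b] - p.[v] in wr.
have -> : p.[b] - p.[a] = D + (P + Q) by rewrite /D /P /Q; ring.
have := sqr_ge0 (P + Q); nra.
Qed.

Lemma variation_gap (R : realType) (X : set R) (p : {poly R}) (a b x y : R) :
  (forall t, X t -> (- (5 / 4) <= t /\ t <= a) \/ (b <= t /\ t <= 5 / 4)) ->
  critical_points_in X p ->
  a <= - 1 -> 1 <= b -> - (5 / 4) <= x -> x < a -> b < y -> y <= 5 / 4 ->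
  `|p.[a] - p.[x]| <= `|p.[b] - p.[a]| \/ `|p.[y] - p.[b]| <= `|p.[b] - p.[a]|.
Proof.
move=> Xab pX a_le b_ge x_ge xa yb y_le.
have [c [s [pE sX]]] := deriv_split_of_critical_points_in pX.
have sab t : t \in s -> t <= a \/ b <= t.
  by move=> /sX/Xab[[_ ?]|[? _]]; [left|right].
(* The sign of [t] tells the left interval from the right one. The comparison interval has length
   1/4, at least that of either outer interval. *)
case: (leqP (count (predC (< 0)) s) (count (< 0) s)) => [le_count|/ltnW le_count].
  left; apply: le_trans
    (variation_le_of_no_root (u := 0) (v := 1 / 4) pE sab _ _ _); try lra.
  apply: (variation_le_of_prod pE); try lra.
  move=> z w; rewrite !in_itv /= => /andP[xz za] /andP[w0 w4].
  apply: prod_dist_le le_count => t /sX/Xab[[t1 t2]|[t1 t2]] /= t0;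
    first [by move: t0; rewrite -?leNgt; lra
          |by rewrite ler_norml ler_normr; split; [|apply/orP; (left + right)]; lra].
(* The mirror image: [[-1/4, 0]] stays at distance at least 1 from the right roots and at least 3/4
   from the left ones. *)
right; apply: le_trans
  (variation_le_of_no_root (u := - (1 / 4)) (v := 0) pE sab _ _ _); try lra.
apply: (variation_le_of_prod pE); try lra.
move=> z w; rewrite !in_itv /= => /andP[xz za] /andP[w0 w4].
have le_count' : (count (predC (predC (< 0)%R)) s <= count (predC (< 0)%R) s)%N.
  by rewrite (eq_count (a2 := (< 0))) // => t /=; rewrite negbK.
apply: prod_dist_le le_count' => t /sX/Xab[[t1 t2]|[t1 t2]] /= t0;
  first [by move: t0; rewrite ?negbK -?leNgt; lra
        |by rewrite ler_norml ler_normr; split; [|apply/orP; (left + right)]; lra].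
Qed.

Lemma compact_max_mem (R : realType) (A : set R) :
  A !=set0 -> compact A -> exists2 m, A m & forall t, A t -> t <= m.
Proof.
move=> A0 cA.
have [|m mA le_m] := @compact_EVT_max _ _ id A A0 cA.
  by apply: continuous_subspaceT => x; exact: cvg_id.
by exists m => [|t At]; [rewrite -in_setE|apply: le_m; rewrite in_setE].
Qed.

Lemma compact_min_mem (R : realType) (A : set R) :
  A !=set0 -> compact A -> exists2 m, A m & forall t, A t -> m <= t.
Proof.
move=> A0 cA.
have [|m mA ge_m] := @compact_EVT_min _ _ id A A0 cA.
  by apply: continuous_subspaceT => x; exact: cvg_id.
by exists m => [|t At]; [rewrite -in_setE|apply: ge_m; rewrite in_setE].
Qed.

Theorem lemma13p1 (R : realType) (eps : R) (X : set R)
    (eps_gt0 : 0 < eps) (eps_lt : eps < 1 / 4)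
    (X_compact : compact X)
    (X_sub : X `<=` `[- 1 - eps, - 1] `|` `[1, 1 + eps])
    (X_left : exists a b : R,
        [/\ a != b, (X `&` `[- 1 - eps, - 1]) a & (X `&` `[- 1 - eps, - 1]) b])
    (X_right : exists a b : R,
        [/\ a != b, (X `&` `[1, 1 + eps]) a & (X `&` `[1, 1 + eps]) b]) :
  exists f : R -> R, {within X, continuous f} /\
    ~ uniformly_approximable X [set p | critical_points_in X p] f.
Proof.
have Xitv u v : compact (X `&` `[u, v]).
  by apply: compact_closedI => //; exact: itv_closed.
have [a [Xa a_itv] a_max] : exists2 a, (X `&` `[- 1 - eps, - 1]) a &
    forall t, (X `&` `[- 1 - eps, - 1]) t -> t <= a.
  by apply: compact_max_mem => //; case: X_left => t [_ [_ Xt _]]; exists t.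
have [b [Xb b_itv] b_min] : exists2 b, (X `&` `[1, 1 + eps]) b &
    forall t, (X `&` `[1, 1 + eps]) t -> b <= t.
  by apply: compact_min_mem => //; case: X_right => t [_ [_ Xt _]]; exists t.
(* Of two distinct points, at least one differs from [a]. *)
have [x [Xx x_itv] x_neq] : exists2 x, (X `&` `[- 1 - eps, - 1]) x & x != a.
  have [x [y [xy Xx Xy]]] := X_left.
  by have [xa|] := eqVneq x a; [exists y; rewrite // -xa eq_sym|exists x].
have [y [Xy y_itv] y_neq] : exists2 y, (X `&` `[1, 1 + eps]) y & y != b.
  have [z [y [zy Xz Xy]]] := X_right.
  by have [zb|] := eqVneq z b; [exists y; rewrite // -zb eq_sym|exists z].
have xa : x < a by rewrite lt_neqAle x_neq a_max.
have yb : b < y by rewrite lt_neqAle eq_sym y_neq b_min.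
have Xab t : X t -> (- (5 / 4) <= t /\ t <= a) \/ (b <= t /\ t <= 5 / 4).
  move=> Xt; have [] := X_sub t Xt => t_itv; [left|right]; split.
  - by move: t_itv; rewrite /= in_itv /=; lra.
  - exact: a_max.
  - exact: b_min.
  - by move: t_itv; rewrite /= in_itv /=; lra.
move: a_itv b_itv x_itv y_itv; rewrite /= !in_itv /= => a_itv b_itv x_itv y_itv.
pose q : {poly R} := ('X - a%:P) * ('X - b%:P).
have qE t : q.[t] = (t - a) * (t - b) by rewrite hornerM !hornerXsubC.
exists (horner q); split.
  by apply: continuous_subspaceT => t; exact: continuous_horner.
(* At [x] both factors of [q] are negative, at [y] both are positive. *)
pose d := Num.min q.[x] q.[y].
have d_gt0 : 0 < d.
  rewrite lt_min !qE nmulr_rgt0 ?pmulr_rgt0; lra.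
(* With error below [d / 4], the values of [p] at [a] and [b] differ by less than [d / 2], while
   those at [a] and [x], and at [b] and [y], differ by more than [d / 2]. This contradicts
   [variation_gap]. *)
move=> /(_ (d / 4))[|p /= pX p_near]; first by lra.
have dx : d <= q.[x] by rewrite ge_min lexx.
have dy : d <= q.[y] by rewrite ge_min lexx orbT.
have qa : q.[a] = 0 by rewrite qE subrr mul0r.
have qb : q.[b] = 0 by rewrite qE subrr mulr0.
move: (p_near a Xa) (p_near b Xb) (p_near x Xx) (p_near y Xy).
rewrite qa qb !ltr_norml => pa pb px py.
have gap : `|p.[b] - p.[a]| < d / 2 by rewrite ltr_norml; lra.
have [] := variation_gap Xab pX (a := a) (b := b) (x := x) (y := y); try lra.
  by move=> /le_lt_trans/(_ gap); rewrite ltr_norml; lra.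
by move=> /le_lt_trans/(_ gap); rewrite ltr_norml; lra.
Qed.
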